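(* For every graph $H$ with $t$ vertices, every graph $G$ that does not contain $H$ as a weak immersion has a tree decomposition with adhesion at most $t^2$ such that every torso has $(t,\,t^4+2t^2)$-bounded degree.
   Context: All graphs are finite and simple. $G$ contains $H$ as a weak immersion (immersion) if the vertices of $H$ can be mapped to distinct vertices of $G$ and the edges of $H$ to pairwise edge-disjoint paths in $G$, each edge $vw$ of $H$ mapped to a path whose endpoints are the images of $v$ and $w$. For a tree $T$, a $T$-decomposition (tree decomposition) of $G$ is a collection $(T_x\subseteq V(G):x\in V(T))$ of bags such that for each $v\in V(G)$, $\{x: v\in T_x\}$ induces a connected subtree of $T$, and each edge of $G$ has both endpoints in some bag. Its adhesion is $\max\{|T_x\cap T_y|: xy\in E(T)\}$. The torso of a node $x$ is the graph obtained from $G[T_x]$ by adding a clique on $T_x\cap T_y$ for each edge $xy\in E(T)$ incident to $x$. For integers $c,d\ge 0$, a graph has $(c,d)$-bounded degree if it contains at most $c$ vertices of degree greater than $d$. *)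

(* Defs.v *)
From mathcomp Require Import all_boot.

Set Implicit Arguments.
Unset Strict Implicit.
Unset Printing Implicit Defensive.

Record sgraph := SGraph {
  vertex :> finType;
  adj : rel vertex;
  adj_sym : symmetric adj;
  adj_irrefl : irreflexive adj
}.

Notation "x -- y" := (adj x y) (at level 30, no associativity).

Definition edges (G : sgraph) : {set {set G}} :=
  [set [set p.1; p.2] | p : G * G & p.1 -- p.2].

Definition degree (G : sgraph) (v : G) : nat := #|[set w : G | v -- w]|.

Definition bounded_degree (c d : nat) (G : sgraph) : Prop :=
  #|[set v : G | d < degree v]| <= c.

Section Induced.
Variables (G : sgraph) (A : {set G}).

Definition induced_adj : rel {v : G | v \in A} :=
  fun u v => val u -- val v.

Lemma induced_adj_sym : symmetric induced_adj.
Proof. by move=> u v; apply: adj_sym. Qed.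

Lemma induced_adj_irrefl : irreflexive induced_adj.
Proof. by move=> u; apply: adj_irrefl. Qed.

Definition induced : sgraph := SGraph induced_adj_sym induced_adj_irrefl.

End Induced.

(* A path is given by the sequence of all its vertices, both ends included. *)
Definition is_path (G : sgraph) (x y : G) (p : seq G) : Prop :=
  exists q : seq G,
    [/\ p = x :: q, path (@adj G) x q, last x q = y & uniq p].

Definition path_edges (G : sgraph) (p : seq G) : seq {set G} :=
  if p is x :: q then pairmap (fun u v => [set u; v]) x q else [::].

(* Edges of H are unordered, so [P [set v; w]] may list its path from either
   end. *)
Definition weak_immersion (H G : sgraph) : Prop :=
  exists (f : H -> G) (P : {set H} -> seq G),
    [/\ injective f,
        forall v w : H, v -- w ->
          is_path (f v) (f w) (P [set v; w]) \/
          is_path (f w) (f v) (P [set v; w])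
      & forall e1 e2 : {set H}, e1 \in edges H -> e2 \in edges H -> e1 != e2 ->
          forall e : {set G},
            ~ (e \in path_edges (P e1) /\ e \in path_edges (P e2))].

(* The null graph is not connected. *)
Definition connected_graph (G : sgraph) : Prop :=
  0 < #|G| /\ forall x y : G, connect (@adj G) x y.

(* [ucycle] also accepts sequences of size at most 2 (the empty sequence and
   the two ends of an edge), which are not cycles of a simple graph. *)
Definition acyclic (G : sgraph) : Prop :=
  forall c : seq G, ucycle (@adj G) c -> size c <= 2.

Definition is_tree (T : sgraph) : Prop := connected_graph T /\ acyclic T.

Definition tree_decomposition (G T : sgraph) (B : T -> {set G}) : Prop :=
  [/\ is_tree T,
      forall v : G, connected_graph (induced [set x : T | v \in B x])
    & forall u v : G, u -- v -> exists x : T, u \in B x /\ v \in B x].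

Definition adhesion (G T : sgraph) (B : T -> {set G}) : nat :=
  \max_(p : T * T | p.1 -- p.2) #|B p.1 :&: B p.2|.

Section Torso.
Variables (G T : sgraph) (B : T -> {set G}) (x : T).

Definition torso_adj : rel (induced (B x)) :=
  fun u v => u -- v ||
    (u != v) && [exists y : T, [&& x -- y, val u \in B x :&: B y
                                         & val v \in B x :&: B y]].

Lemma torso_adj_sym : symmetric torso_adj.
Proof.
move=> u v; rewrite /torso_adj adj_sym eq_sym; congr (_ || _ && _).
by apply: eq_existsb => y; rewrite [X in _ && X]andbC.
Qed.

Lemma torso_adj_irrefl : irreflexive torso_adj.
Proof. by move=> u; rewrite /torso_adj adj_irrefl eqxx. Qed.

Definition torso : sgraph := SGraph torso_adj_sym torso_adj_irrefl.

End Torso.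

(* Main.v *)
Require Import Defs.
From mathcomp Require Import all_boot zify.

Set Implicit Arguments.
Unset Strict Implicit.
Unset Printing Implicit Defensive.

(* Call a set X of vertices a separator of u and v if it contains exactly one of
   them. Breaking ties between cut sizes by an injective modular weight makes
   the minimum separator of each pair unique, and uncrossing shows that all
   these minimum separators form a laminar family. Keep those with at most t^2
   leaving edges, add the whole vertex set, and order the members into a rooted
   tree by inclusion. The bag of a member A consists of its core (the vertices
   of A in no smaller member) and, for each child C of A, the vertices of C with
   a neighbour outside C. Adhesion sets are then boundaries of members, and a
   vertex of the bag outside the core has torso degree at most 3 t^2.

   Two vertices of the same core are separated by no cut of at most t^2 edges.
   If a core had more than t vertices, one of them could serve as a hub, joined
   by edge-disjoint paths, t to each of t others; pairing up these paths at the
   hub would immerse every graph on t vertices. *)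

Section SetFunctions.
Variable T : finType.
Implicit Types (f g : {set T} -> nat) (X Y : {set T}).

Definition modular f := forall X Y, f (X :&: Y) + f (X :|: Y) = f X + f Y.

Definition submodular f :=
  forall X Y, f (X :&: Y) + f (X :|: Y) <= f X + f Y.

Definition posimodular f :=
  forall X Y, f (X :\: Y) + f (Y :\: X) <= f X + f Y.

Lemma modular_card_preimset (I : finType) (y : I -> T) :
  modular (fun X => #|y @^-1: X|).
Proof. by move=> X Y; rewrite preimsetI preimsetU addnC cardsUI. Qed.

Lemma modular_sum (w : T -> nat) : modular (fun X => \sum_(x in X) w x).
Proof.
move=> X Y; rewrite (big_setID X (A := X :|: Y)) (big_setID X (A := Y)) /=.
by rewrite setUK setDUl setDv set0U setIC addnCA.
Qed.

Lemma posimodular_sum (w : T -> nat) :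
  posimodular (fun X => \sum_(x in X) w x).
Proof.
move=> X Y; rewrite (big_setID Y (A := X)) (big_setID X (A := Y)) /=.
by rewrite leq_add ?leq_addl.
Qed.

Lemma submodular_muladd n f g :
  submodular f -> submodular g -> submodular (fun X => n * f X + g X).
Proof.
move=> sub_f sub_g X Y; rewrite addnACA -mulnDr [leqRHS]addnACA -mulnDr.
by rewrite leq_add ?leq_mul.
Qed.

Lemma posimodular_muladd n f g :
  posimodular f -> posimodular g -> posimodular (fun X => n * f X + g X).
Proof.
move=> pos_f pos_g X Y; rewrite addnACA -mulnDr [leqRHS]addnACA -mulnDr.
by rewrite leq_add ?leq_mul.
Qed.

Lemma posimodular_symmetric f :
  (forall X, f (~: X) = f X) -> submodular f -> posimodular f.
Proof.
move=> fC sub_f X Y; have := sub_f X (~: Y).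
by rewrite fC -setDE -(fC (X :|: ~: Y)) setCU setCK setIC -setDE.
Qed.

End SetFunctions.

Section EnteringArcs.
Variable T : finType.
Implicit Types (D : {set T * T}) (X Y : {set T}) (a : T * T).

Definition entering D X := D :&: setX (~: X) X.

Definition indeg D X := #|entering D X|.

Lemma mem_entering D X a :
  (a \in entering D X) = [&& a \in D, a.1 \notin X & a.2 \in X].
Proof. by rewrite !inE. Qed.

Lemma indegIU D X Y :
  indeg D (X :&: Y) + indeg D (X :|: Y)
    + #|D :&: setX (X :\: Y) (Y :\: X)| + #|D :&: setX (Y :\: X) (X :\: Y)|
  = indeg D X + indeg D Y.
Proof.
rewrite /indeg; have cardE A : #|D :&: A| = \sum_(a in D) (a \in A).
  by rewrite -sum1_card (eq_bigl _ _ (fun a => in_setI a D A)) big_mkcondr.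
rewrite !cardE -!big_split; apply: eq_bigr => a _; rewrite !inE /=.
by case: (a.1 \in X); case: (a.1 \in Y); case: (a.2 \in X); case: (a.2 \in Y).
Qed.

Lemma submodular_indeg D : submodular (indeg D).
Proof. by move=> X Y; rewrite -(indegIU D X Y) -addnA leq_addr. Qed.

Lemma indegD1 D X a : a \in D ->
  indeg D X = ((a.1 \notin X) && (a.2 \in X)) + indeg (D :\ a) X.
Proof.
by move=> aD; rewrite /indeg (cardsD1 a) mem_entering aD /entering setIDAC.
Qed.

End EnteringArcs.

Section Cuts.
Variable G : sgraph.
Implicit Types (X : {set G}) (v w : G).

Definition arcs : {set G * G} := [set a | a.1 -- a.2].

Definition cut X := indeg arcs X.

Lemma submodular_cut : submodular cut.
Proof. exact: submodular_indeg. Qed.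

Lemma cutC X : cut (~: X) = cut X.
Proof.
rewrite /cut /indeg -(card_imset _ (inv_inj (@swap_pairK G G))).
rewrite (can_imset_pre _ (@swap_pairK G G)); apply: eq_card => a.
by rewrite !inE /= adj_sym negbK [X in _ && X]andbC.
Qed.

Lemma posimodular_cut : posimodular cut.
Proof. exact: posimodular_symmetric cutC submodular_cut. Qed.

Lemma cutT : cut setT = 0.
Proof. by apply: eq_card0 => a; rewrite mem_entering in_setT andbF. Qed.

Definition boundary X := [set a.2 | a in entering arcs X].

Lemma boundaryP X v :
  reflect (v \in X /\ exists2 w, v -- w & w \notin X) (v \in boundary X).
Proof.
apply: (iffP imsetP) => [[[w v']]|[vX [w vw wX]]].
  rewrite mem_entering inE /= => /and3P[wv wX vX] ->.
  by split=> //; exists w; rewrite // adj_sym.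
by exists (w, v); rewrite // mem_entering inE /= adj_sym vw wX.
Qed.

Lemma card_boundary X : #|boundary X| <= cut X.
Proof. exact: leq_imset_card. Qed.

Lemma card_outer_neighbours X v : v \in X ->
  #|[set w | (v -- w) && (w \notin X)]| <= cut X.
Proof.
move=> vX; apply: leq_trans (leq_imset_card fst _).
apply/subset_leq_card/subsetP => w; rewrite inE => /andP[vw wX].
by apply/imsetP; exists (w, v); rewrite // mem_entering inE /= adj_sym vw wX.
Qed.

End Cuts.

Section ArcDisjointPaths.
Variables (T I : finType) (s : T).
Implicit Types (D : {set T * T}) (y : I -> T) (X Y : {set T}) (a : T * T).

Definition cut_condition D y :=
  [forall (X : {set T} | s \notin X), #|y @^-1: X| <= indeg D X].

Lemma cut_conditionP D y :
  reflect (forall X, s \notin X -> #|y @^-1: X| <= indeg D X)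
          (cut_condition D y).
Proof. exact: forall_inP. Qed.

Definition tight D y X := (s \notin X) && (#|y @^-1: X| == indeg D X).

Lemma tight0 D y : tight D y set0.
Proof.
rewrite /tight in_set0 preimset0 cards0 eq_sym cards_eq0.
by apply/eqP/setP => a; rewrite mem_entering !inE !andbF.
Qed.

Section Tight.
Variables (D : {set T * T}) (y : I -> T).
Hypothesis cutD : cut_condition D y.

Lemma tight_uncross X Y : tight D y X -> tight D y Y ->
  tight D y (X :|: Y) /\ D :&: setX (Y :\: X) (X :\: Y) = set0.
Proof.
move=> /andP[sX /eqP tightX] /andP[sY /eqP tightY].
have sI : s \notin X :&: Y by rewrite inE negb_and sX.
have sU : s \notin X :|: Y by rewrite inE negb_or sX.
have := cut_conditionP _ _ cutD _ sI; have := cut_conditionP _ _ cutD _ sU.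
have /= := modular_card_preimset y X Y; have := indegIU D X Y.
move=> indegE cardE leU leI; split; first by rewrite /tight sU /=; lia.
by apply/eqP; rewrite -cards_eq0; lia.
Qed.

(* The union W of the tight sets avoiding y i is tight, so an arc entering W
   together with y i must start outside W. *)
Lemma last_arc_exists i : y i != s ->
  exists2 z, (z, y i) \in D &
    forall X, tight D y X -> y i \notin X -> z \notin X.
Proof.
move=> yi_s; pose W := \bigcup_(X | tight D y X && (y i \notin X)) X.
have /andP[tW yiW] : tight D y W && (y i \notin W).
  apply: (big_ind (fun X => tight D y X && (y i \notin X))) => //.
    by rewrite tight0 inE.
  move=> X Y /andP[tX yX] /andP[tY yY].
  by rewrite (tight_uncross tX tY).1 inE negb_or yX.
have /andP[sW /eqP cardW] := tW.
have sUW : s \notin y i |: W by rewrite !inE negb_or eq_sym yi_s.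
have lt_preim : #|y @^-1: W| < #|y @^-1: (y i |: W)|.
  apply/proper_card/properP; split; first exact/preimsetS/subsetUr.
  by exists i; rewrite !inE ?eqxx.
have lt_indeg : indeg D W < indeg D (y i |: W).
  by have := cut_conditionP _ _ cutD _ sUW; lia.
have /subsetPn[[z v]] : ~~ (entering D (y i |: W) \subset entering D W).
  by apply: contraTN lt_indeg => /subset_leq_card; rewrite -leqNgt.
rewrite !mem_entering !inE negb_or /= => /and3P[zvD /andP[_ zW] vUW].
rewrite zvD zW /= => vW; move: vUW; rewrite (negPf vW) orbF => /eqP v_yi.
exists z => [|X tX yX]; first by rewrite -v_yi.
apply: contra zW => zX.
by apply/bigcupP; exists X; rewrite // tX.
Qed.

Lemma cut_condition_retarget i z : (z, y i) \in D ->
  (forall X, tight D y X -> y i \notin X -> z \notin X) ->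
  cut_condition (D :\ (z, y i)) [eta y with i |-> z].
Proof.
move=> zyD z_tight; apply/cut_conditionP => X sX.
have card_retarget : #|[eta y with i |-> z] @^-1: X| + (y i \in X)
    = #|y @^-1: X| + (z \in X).
  have off_i : ([eta y with i |-> z] @^-1: X) :\ i = (y @^-1: X) :\ i.
    by apply/setP => j; rewrite !inE /=; case: eqP.
  rewrite (cardsD1 i) off_i (cardsD1 i (y @^-1: X)) !inE /= eqxx; lia.
have := cut_conditionP _ _ cutD X sX; have := z_tight X.
rewrite /tight sX (indegD1 X zyD) /=.
move: card_retarget; case: (y i \in X); case: (z \in X) => /=; lia.
Qed.

End Tight.

(* The paths are disjoint because the one to y i uses only arcs labelled Some i;
   it is found by moving its end y i backwards along a last arc. *)
Lemma arc_disjoint_paths D y : cut_condition D y ->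
  exists c : T * T -> option I, forall i,
    connect (fun u v => ((u, v) \in D) && (c (u, v) == Some i)) s (y i).
Proof.
have [n] := ubnP #|D|; elim: n D y => // n IHn D y ltDn cutD.
have [/existsP[i yi_s]|/existsPn y_s] := boolP [exists i, y i != s]; last first.
  by exists (fun=> None) => i; rewrite (eqP (negbNE (y_s i))).
have [z zyD z_tight] := last_arc_exists cutD yi_s.
have [|c paths] := IHn _ _ _ (cut_condition_retarget cutD zyD z_tight).
  by move: ltDn; rewrite (cardsD1 (z, y i) D) zyD.
exists [eta c with (z, y i) |-> Some i] => j.
set r := (fun u v => _); have keep_path : connect r s ([eta y with i |-> z] j).
  apply: connect_sub (paths j) => u v /andP[/setD1P[uvN uvD] cuv].
  by apply: connect1; rewrite /r uvD /= (negPf uvN).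
move: keep_path => /=; case: eqP => [ji|//] path_z.
by apply: connect_trans path_z (connect1 _); rewrite /r ji zyD /= !eqxx.
Qed.

Lemma minset_arc_enters_tight D y a : minset (cut_condition^~ y) D -> a \in D ->
  exists X, [/\ tight D y X, a.1 \notin X & a.2 \in X].
Proof.
move=> minD aD; have : ~~ cut_condition (D :\ a) y.
  apply/negP => /(minsetinf minD); rewrite subsetDl => /(_ isT)/setP/(_ a).
  by rewrite !inE eqxx aD.
rewrite negb_forall_in => /exists_inP[X sX]; rewrite -ltnNge => ltX; exists X.
rewrite /tight sX; have := cut_conditionP _ _ (minsetp minD) X sX.
move: (indegD1 X aD) ltX.
by case: (a.1 \in X); case: (a.2 \in X) => /=; split=> //; lia.
Qed.

(* In a minimal arc set, u -> v and v -> u would each enter a tight set, but no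
   arc joins the two differences of tight sets. *)
Lemma cut_condition_orientation D y : cut_condition D y ->
  exists D' : {set T * T}, [/\ D' \subset D, cut_condition D' y
    & forall u v, (u, v) \in D' -> (v, u) \notin D'].
Proof.
move=> cutD; have [D' minD' sD'] :=
  minset_exists (P := cut_condition^~ y) cutD.
exists D'; split=> // [|u v uvD]; first exact: minsetp minD'.
have [X [tX /= uX vX]] := minset_arc_enters_tight minD' uvD.
apply/negP => vuD; have [Y [tY /= vY uY]] := minset_arc_enters_tight minD' vuD.
have [_ /setP/(_ (u, v))] := tight_uncross (minsetp minD') tX tY.
by rewrite in_set0 in_setI in_setX !in_setD uvD uX uY vX vY.
Qed.

End ArcDisjointPaths.

Lemma set2_inj (T : finType) (a b c d : T) :
  [set a; b] = [set c; d] -> (a = c /\ b = d) \/ (a = d /\ b = c).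
Proof.
move=> eq_ab; have /set2P a_cd : a \in [set c; d] by rewrite -eq_ab set21.
have /set2P b_cd : b \in [set c; d] by rewrite -eq_ab set22.
have /set2P c_ab : c \in [set a; b] by rewrite eq_ab set21.
have /set2P d_ab : d \in [set a; b] by rewrite eq_ab set22.
by case: a_cd b_cd c_ab d_ab => ? [] ? [] ? [] ?; subst; auto.
Qed.

Section EdgeLabellings.
Variable G : sgraph.
Implicit Types (x y u v s : G) (X : {set G}).

Definition labelled_adj (C : eqType) (c : {set G} -> C) (i : C) : rel G :=
  fun u v => (u -- v) && (c [set u; v] == i).

Lemma labelled_adj_sym (C : eqType) (c : {set G} -> C) i :
  symmetric (labelled_adj c i).
Proof. by move=> u v; rewrite /labelled_adj adj_sym setUC. Qed.

Lemma path_labelled_adj (C : eqType) (c : {set G} -> C) i x q :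
  path (labelled_adj c i) x q
  = path (@adj G) x q && all (fun e => c e == i) (path_edges (x :: q)).
Proof. by elim: q x => //= y q IHq x; rewrite IHq andbACA. Qed.

Lemma labelled_path (C : eqType) (c : {set G} -> C) i x y :
  connect (labelled_adj c i) x y ->
  exists2 p, is_path x y p & {in path_edges p, forall e, c e = i}.
Proof.
case/connectP=> q0 path_q0 ->; case: (shortenP path_q0) => q path_q uniq_q _.
move: path_q; rewrite path_labelled_adj => /andP[path_q /allP label_q].
by exists (x :: q) => [|e /label_q/eqP //]; exists q.
Qed.

Lemma edge_disjoint_paths (I : finType) s (y : I -> G) :
  (forall X, s \notin X -> #|y @^-1: X| <= cut X) ->
  exists c : {set G} -> option I,
    forall i, connect (labelled_adj c (Some i)) s (y i).
Proof.
move/cut_conditionP=> cut_arcs.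
have [D [sD cutD antiD]] := cut_condition_orientation cut_arcs.
have [c paths] := arc_disjoint_paths cutD.
pose c_edge e :=
  if [pick a in D | [set a.1; a.2] == e] is Some a then c a else None.
exists c_edge => i; apply: connect_sub (paths i) => u v /andP[uvD cuv].
apply: connect1; move: (subsetP sD _ uvD).
rewrite inE /labelled_adj /c_edge /= => -> /=.
case: pickP => [[u' v']|/(_ (u, v))] /=; last by rewrite uvD eqxx.
case/andP=> uvD' /eqP/set2_inj[[-> ->] //|[u'v v'u]].
by have := antiD _ _ uvD; rewrite -u'v -v'u uvD'.
Qed.

End EdgeLabellings.

Section Immersion.
Variables H G : sgraph.

Lemma weak_immersion_of_labelling (f : H -> G) (c : {set G} -> {set H}) :
  injective f ->
  (forall v w, v -- w -> connect (labelled_adj c [set v; w]) (f v) (f w)) ->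
  weak_immersion H G.
Proof.
move=> injf conn_f.
have [|route routeP] := @fin_all_exists {set H} (fun=> seq G) (fun e p =>
    {in path_edges p, forall e', c e' = e} /\
    forall v w, v -- w -> e = [set v; w] ->
      is_path (f v) (f w) p \/ is_path (f w) (f v) p).
  move=> e; have [/imsetP[[v w]]|eN] := boolP (e \in edges H); last first.
    exists [::]; split=> // v w vw e_vw; case/negP: eN.
    by apply/imsetP; exists (v, w); rewrite ?inE.
  rewrite inE /= => vw ->.
  have [p path_p label_p] := labelled_path (conn_f v w vw).
  by exists p; split=> // v' w' _ /set2_inj[[<- <-]|[<- <-]]; [left|right].
exists f, route; split=> // [v w vw|e1 e2 _ _ neq_e e [e_e1 e_e2]].
  exact: (routeP _).2.
by case/eqP: neq_e; rewrite -((routeP e1).1 e) // ((routeP e2).1 e).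
Qed.

(* The paths from the hub s are indexed by H * H: the edge vw of H is routed
   along the paths (v, w) and (w, v). *)
Lemma weak_immersion_of_hub (s : G) (f : H -> G) :
  injective f ->
  (forall (X : {set G}) v, s \notin X -> f v \in X -> #|H| ^ 2 <= cut X) ->
  weak_immersion H G.
Proof.
move=> injf hub; pose y (i : H * H) := f i.1.
have [X sX|c paths] := edge_disjoint_paths (s := s) (y := y).
  have [->|/set0Pn[[v w]]] := eqVneq (y @^-1: X) set0; first by rewrite cards0.
  rewrite inE => fvX; apply: leq_trans (hub X v sX fvX).
  by rewrite -mulnn -card_prod max_card.
pose c_edge e := if c e is Some (v, w) then [set v; w] else set0.
have to_hub v w : connect (labelled_adj c_edge [set v; w]) s (f v).
  apply: connect_sub (paths (v, w)) => a b /andP[ab /eqP cab].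
  by apply: connect1; rewrite /labelled_adj /c_edge ab cab eqxx.
apply: (weak_immersion_of_labelling (c := c_edge) injf) => v w _.
apply: (@connect_trans _ _ s); last by rewrite setUC; apply: to_hub.
by rewrite (sym_connect_sym (labelled_adj_sym _ _)); apply: to_hub.
Qed.

End Immersion.

Lemma sum_bits_inj n (a b : 'I_n -> bool) :
  \sum_(i < n) a i * 2 ^ i = \sum_(i < n) b i * 2 ^ i -> a =1 b.
Proof.
elim: n a b => [|n IHn] a b; first by move=> _ [].
have low_bit (c : 'I_n.+1 -> bool) : \sum_(i < n.+1) c i * 2 ^ i
    = c ord0 + (\sum_(i < n) c (lift ord0 i) * 2 ^ i).*2.
  rewrite big_ord_recl muln1 -muln2 big_distrl; congr (_ + _).
  by apply: eq_bigr => i _; rewrite lift0 expnSr mulnA.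
rewrite !low_bit => eq_sum.
have eq0 : a ord0 = b ord0.
  by move/(congr1 odd): eq_sum; rewrite !oddD !odd_double !addbF !oddb.
move: eq_sum; rewrite eq0 => /addnI/double_inj/IHn eqS i.
by case: (unliftP ord0 i) => [j|] -> //; apply: eqS.
Qed.

Section LaminarSeparators.
Variable T : finType.
Implicit Types (f g : {set T} -> nat) (X Y Z : {set T}) (u v x : T).

Definition separates u v X := (u \in X) != (v \in X).

Lemma separatesC u v X : separates u v X = separates v u X.
Proof. by rewrite /separates eq_sym. Qed.

Lemma mem_notin_separates u v X : u \in X -> v \notin X -> separates u v X.
Proof. by rewrite /separates => -> /negPf->. Qed.

Definition laminar (L : {set {set T}}) := forall X Y, X \in L -> Y \in L ->
  [\/ X \subset Y, Y \subset X | [disjoint X & Y]].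

Lemma laminar_nested L X Y x : laminar L -> X \in L -> Y \in L ->
  x \in X -> x \in Y -> X \subset Y \/ Y \subset X.
Proof.
move=> lamL XL YL xX xY; case: (lamL X Y XL YL) => [||dXY]; [by left|by right|].
by move: (disjointFr dXY xX); rewrite xY.
Qed.

Lemma laminar_setU1T L : laminar L -> laminar (setT |: L).
Proof.
move=> lamL X Y /setU1P[->|XL]; first by constructor 2.
by case/setU1P=> [->|YL]; [constructor 1|apply: lamL].
Qed.

Definition min_separator f u v X :=
  separates u v X && [forall Y, separates u v Y ==> (f X <= f Y)].

Lemma min_separatorP f u v X :
  reflect (separates u v X /\ forall Y, separates u v Y -> f X <= f Y)
          (min_separator f u v X).
Proof.
apply: (iffP andP) => -[sX minX]; split=> //.
  by move=> Y; apply/implyP/(forallP minX).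
by apply/forallP => Y; apply/implyP/minX.
Qed.

Lemma min_separatorC f u v X : min_separator f u v X = min_separator f v u X.
Proof.
rewrite /min_separator separatesC; congr andb.
by apply: eq_forallb => Y; rewrite separatesC.
Qed.

Definition min_separators f :=
  [set X | [exists u, exists v, min_separator f u v X]].

Lemma min_separatorsP f X :
  reflect (exists u v, [/\ u \in X, v \notin X & min_separator f u v X])
          (X \in min_separators f).
Proof.
rewrite inE; apply: (iffP existsP) => [[u /existsP[v minX]]|[u [v [_ _ minX]]]].
  have /andP[+ _] := minX; rewrite /separates.
  case: (boolP (u \in X)) (boolP (v \in X)) => uX [] vX // _.
    by exists u, v.
  by exists v, u; rewrite min_separatorC.
by exists u; apply/existsP; exists v.
Qed.

Lemma min_separator_exists f u v X : separates u v X ->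
  exists2 Y, min_separator f u v Y & f Y <= f X.
Proof.
move=> sX; case: (arg_minnP f sX) => Y sY minY; exists Y; last exact: minY.
exact/min_separatorP.
Qed.

Section Uncrossing.
Variable f : {set T} -> nat.
Hypotheses (inj_f : injective f) (sub_f : submodular f) (pos_f : posimodular f).

Lemma min_separator_uncross X Y Z Z' u v a b :
  min_separator f u v X -> min_separator f a b Y ->
  separates u v Z -> separates a b Z' -> f Z + f Z' <= f X + f Y ->
  Z = X /\ Z' = Y.
Proof.
move=> /min_separatorP[_ minX] /min_separatorP[_ minY] /minX leX /minY leY leXY.
by split; apply: inj_f; lia.
Qed.

Lemma laminar_min_separators_lt X Y :
  X \in min_separators f -> Y \in min_separators f -> f X < f Y ->
  [\/ X \subset Y, Y \subset X | [disjoint X & Y]].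
Proof.
case/min_separatorsP=> u [v [uX vX minX]].
move=> /min_separatorsP[a [b [aY bY minY]]] ltXY.
have uncross := min_separator_uncross minX minY.
have : ~~ separates a b X.
  by apply/negP; have /min_separatorP[_ /(_ X)] := minY; lia.
rewrite /separates negbK; case: (boolP (a \in X)) => aX /eqP/esym bX.
- have [vY|vY] := boolP (v \in Y).
  + case: (uncross (Y :\: X) (X :\: Y)) => [||| eqX _].
    * rewrite separatesC; apply: mem_notin_separates;
        by rewrite !inE ?uX ?vX ?vY.
    * rewrite separatesC; apply: mem_notin_separates;
        by rewrite !inE ?aY ?bX ?bY.
    * by rewrite addnC pos_f.
    by have := uX; rewrite -{1}eqX inE uX.
  + case: (uncross (X :|: Y) (X :&: Y)) => [||| eqX _].
    * by apply: mem_notin_separates; rewrite !inE ?uX // negb_or vX.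
    * by apply: mem_notin_separates; rewrite !inE ?aX // negb_and bY orbT.
    * by rewrite addnC sub_f.
    by constructor 2; rewrite -eqX subsetUr.
- have [uY|uY] := boolP (u \in Y).
  + case: (uncross (X :&: Y) (X :|: Y)) => [||| _ eqY].
    * by apply: mem_notin_separates; rewrite !inE ?uX // negb_and vX.
    * by apply: mem_notin_separates; rewrite !inE ?aY ?orbT // negb_or bX.
    * exact: sub_f.
    by constructor 1; rewrite -eqY subsetUl.
  + case: (uncross (X :\: Y) (Y :\: X)) => [||| eqX _].
    * by apply: mem_notin_separates; rewrite !inE ?uX ?uY // negb_and vX orbT.
    * by apply: mem_notin_separates; rewrite !inE ?aX ?aY // negb_and bY orbT.
    * exact: pos_f.
    by constructor 3; rewrite -eqX -setI_eq0 setIDAC -setIDA setDv setI0.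
Qed.

Lemma laminar_min_separators : laminar (min_separators f).
Proof.
move=> X Y XL YL; have [lt|gt|/inj_f->] := ltngtP (f X) (f Y).
- exact: laminar_min_separators_lt.
- have [YX|XY|dYX] := laminar_min_separators_lt YL XL gt.
  + by constructor 2.
  + by constructor 1.
  + by constructor 3; rewrite disjoint_sym.
- by constructor 1.
Qed.

End Uncrossing.

Lemma sum_expn2_enum_rank_inj :
  injective (fun X : {set T} => \sum_(x in X) 2 ^ enum_rank x).
Proof.
have bits X : \sum_(x in X) 2 ^ enum_rank x
    = \sum_(i < #|T|) (enum_val i \in X) * 2 ^ i.
  rewrite big_mkcond (reindex _ (onW_bij _ (@enum_val_bij T))) /=.
  by apply: eq_bigr => i _; rewrite enum_valK; case: (_ \in X); rewrite ?mul1n.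
move=> X Y; rewrite /= !bits => /sum_bits_inj eqXY.
by apply/setP => x; rewrite -(enum_rankK x) eqXY.
Qed.

(* Ties between values of f are broken by adding a modular term smaller than
   the scaling factor of f. *)
Lemma injective_refinement f : submodular f -> posimodular f ->
  exists g, [/\ injective g, submodular g, posimodular g
    & forall X Y, g X <= g Y -> f X <= f Y].
Proof.
move=> sub_f pos_f; pose w X := \sum_(x in X) 2 ^ enum_rank x.
pose g X := (w setT).+1 * f X + w X.
have le_wT X : w X <= w setT by rewrite /w [leqRHS](big_setID X) setTI leq_addr.
have le_gf X Y : g X <= g Y -> f X <= f Y.
  rewrite leqNgt [f X <= _]leqNgt; apply: contra => ltYX.
  have lt_gY : g Y < (w setT).+1 * (f Y).+1.
    by rewrite mulnSr /g -addnS leq_add2l ltnS.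
  apply: leq_trans lt_gY (leq_trans _ (leq_addr _ _)).
  by rewrite leq_mul2l ltYX orbT.
exists g; split=> //.
- move=> X Y eq_g; apply: sum_expn2_enum_rank_inj.
  have eq_f : f X = f Y by apply/eqP; rewrite eqn_leq !le_gf ?eq_g.
  by move: eq_g; rewrite /g eq_f => /addnI.
- by apply: submodular_muladd => // X Y; rewrite modular_sum.
- by apply: posimodular_muladd => //; apply: posimodular_sum.
Qed.

Lemma laminar_separators f k : submodular f -> posimodular f ->
  exists L, [/\ laminar L, set0 \notin L, forall X, X \in L -> f X <= k
    & forall X u v, f X <= k -> separates u v X ->
        exists2 Y, Y \in L & separates u v Y].
Proof.
move=> sub_f pos_f.
have [g [inj_g sub_g pos_g le_gf]] := injective_refinement sub_f pos_f.
exists [set X in min_separators g | f X <= k]; split.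
- move=> X Y /setIdP[XL _] /setIdP[YL _].
  exact: (laminar_min_separators inj_g sub_g pos_g).
- by apply/negP => /setIdP[/min_separatorsP[u [v []]]]; rewrite inE.
- by move=> X /setIdP[].
- move=> X u v leXk sX; have [Y minY leYX] := min_separator_exists g sX.
  have /andP[sY _] := minY; exists Y => //.
  apply/setIdP; split; last exact: leq_trans (le_gf _ _ leYX) leXk.
  by rewrite inE; apply/existsP; exists u; apply/existsP; exists v.
Qed.

End LaminarSeparators.

Lemma connected_of_descent (G : sgraph) (r : G) (d : G -> nat) :
  (forall x, x != r -> exists2 y, x -- y & d y < d x) -> connected_graph G.
Proof.
move=> descent; split; first by apply/card_gt0P; exists r.
have to_r x : connect (@adj G) x r.
  have [n] := ubnP (d x); elim: n x => // n IHn x; rewrite ltnS => le_dx.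
  have [->|/descent[y xy lt_d]] := eqVneq x r; first exact: connect0.
  exact: connect_trans (connect1 xy) (IHn y (leq_trans lt_d le_dx)).
move=> x y; apply: connect_trans (to_r x) _.
by rewrite (sym_connect_sym (@adj_sym G)).
Qed.

(* Both neighbours on a cycle of a vertex maximizing d would be its parents. *)
Lemma acyclic_of_parent (G : sgraph) (parent : rel G) (d : G -> nat) :
  (forall x y, x -- y -> parent x y || parent y x) ->
  (forall x y z, parent x y -> parent x z -> y = z) ->
  (forall x y, parent x y -> d y < d x) ->
  acyclic G.
Proof.
move=> adj_parent parent_uniq lt_d c /andP[cyc_c uniq_c]; rewrite leqNgt.
apply/negP => size_c; have [x0 x0c] : exists x, x \in c.
  by case: c size_c {cyc_c uniq_c} => // x; exists x; rewrite mem_head.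
have [x xc max_x] := @arg_maxnP _ x0 (mem c) d x0c.
have up y : y \in c -> x -- y -> parent x y.
  by move=> /max_x /= le_d /adj_parent/orP[//|/lt_d]; rewrite ltnNge le_d.
have [i c' rot_c] := rot_to xc.
move: cyc_c uniq_c size_c.
rewrite -(rot_cycle i) -(rot_uniq i) -(size_rot i) rot_c.
have mem_c y : y \in x :: c' -> y \in c by rewrite -rot_c mem_rot.
case/lastP: c' {rot_c} mem_c => // -[|y c'] z mem_c //=.
rewrite rcons_path last_rcons => /andP[xy /andP[_ zx]] /and3P[_ yN _] _.
have yz : y = z.
  apply: parent_uniq (up y _ xy) (up z _ _); last by rewrite adj_sym.
    by apply: mem_c; rewrite !inE eqxx orbT.
  by apply: mem_c; rewrite !inE mem_rcons mem_head !orbT.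
by move: yN; rewrite yz mem_rcons mem_head.
Qed.

Section LaminarTree.
Variables (T : finType) (L : {set {set T}}).
Implicit Types (A C D : {set T}) (v : T).

Definition nodes := setT |: L.

Definition parent A C :=
  [&& A \in nodes, C \in nodes, A \proper C
    & [forall (D | D \in nodes), (A \proper D) ==> (C \subset D)]].

Lemma parentP A C :
  reflect [/\ A \in nodes, C \in nodes, A \proper C
            & forall D, D \in nodes -> A \proper D -> C \subset D]
          (parent A C).
Proof.
apply: (iffP and4P) => -[AL CL AC leastC]; split=> //.
  by move=> D DL; apply/implyP; apply: (forall_inP leastC).
by apply/forall_inP => D DL; apply/implyP; apply: leastC.
Qed.

Lemma parent_proper A C : parent A C -> A \proper C.
Proof. by case/parentP. Qed.

Lemma parent_uniq A C D : parent A C -> parent A D -> C = D.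
Proof.
move=> /parentP[_ CL AC leastC] /parentP[_ DL AD leastD].
by apply/eqP; rewrite eqEsubset leastC // leastD.
Qed.

Definition tree_adj : rel {A | A \in nodes} :=
  fun x y => parent (val x) (val y) || parent (val y) (val x).

Lemma tree_adj_sym : symmetric tree_adj.
Proof. by move=> x y; rewrite /tree_adj orbC. Qed.

Lemma tree_adj_irrefl : irreflexive tree_adj.
Proof. by move=> x; rewrite /tree_adj /parent properxx !andbF. Qed.

Definition laminar_tree := SGraph tree_adj_sym tree_adj_irrefl.

Lemma laminar_tree_acyclic : acyclic laminar_tree.
Proof.
apply: (@acyclic_of_parent laminar_tree (fun x y => parent (val x) (val y))
  (fun x => #|~: val x|)) => [//|x y z pxy pxz|x y /parent_proper xy].
- exact/val_inj/(parent_uniq pxy).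
- by rewrite proper_card // properC.
Qed.

Hypotheses (lamL : laminar L) (L0 : set0 \notin L).

Lemma nodes_nested A C v : A \in nodes -> C \in nodes -> v \in A -> v \in C ->
  A \subset C \/ C \subset A.
Proof. exact/laminar_nested/laminar_setU1T. Qed.

Lemma parent_exists A C : A \in nodes -> C \in nodes -> A \proper C ->
  exists2 D, parent A D & D \subset C.
Proof.
move=> AL CL AC; have [A0|[v vA]] := set_0Vmem A.
  move: AL AC; rewrite A0 => /setU1P[->|]; last by rewrite (negPf L0).
  by rewrite properE subsetT andbF.
have [|D minD DC] := @minset_exists _ [pred D in nodes | A \proper D] C.
  by rewrite inE /= CL.
have /andP[DL AD] := minsetp minD; exists D => //.
apply/parentP; split=> // E EL AE.
have vD := subsetP (proper_sub AD) _ vA.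
have vE := subsetP (proper_sub AE) _ vA.
have [//|ED] := nodes_nested DL EL vD vE.
by rewrite (minsetinf minD _ ED) //= EL.
Qed.

Lemma child_exists A C v :
  A \in nodes -> C \in nodes -> C \proper A -> v \in C ->
  exists2 D, parent D A & v \in D.
Proof.
move=> AL CL CA vC; have vA := subsetP (proper_sub CA) _ vC.
have [|D maxD _] := @maxset_exists _
  [pred D in nodes | (D \proper A) && (v \in D)] C.
  by rewrite inE /= CL CA.
have /and3P[DL DA vD] := maxsetp maxD; exists D => //.
apply/parentP; split=> // E EL DE; have vE := subsetP (proper_sub DE) _ vD.
have [//|EA] := nodes_nested AL EL vA vE.
have [//|nAE] := boolP (A \subset E); have := DE.
rewrite (maxsetsup maxD _ (proper_sub DE)) ?properxx //=.
by rewrite EL properE EA nAE.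
Qed.

Lemma siblings_eq A C D v :
  parent C A -> parent D A -> v \in C -> v \in D -> C = D.
Proof.
wlog CD : C D / C \subset D => [wlog_sub pC pD vC vD|].
  have [/parentP[CL _ _ _] /parentP[DL _ _ _]] := (pC, pD).
  have [CD|DC] := nodes_nested CL DL vC vD; first exact: wlog_sub.
  by apply/esym/wlog_sub.
move=> /parentP[_ _ _ leastA] /parentP[DL _ DA _] _ _; apply/eqP.
rewrite eqEproper CD /=; apply: contraL DA => /(leastA D DL) AD.
by rewrite properE AD andbF.
Qed.

Lemma laminar_tree_climb (x r : laminar_tree) : val x \proper val r ->
  exists y : laminar_tree,
    [/\ x -- y, val x \proper val y & val y \subset val r].
Proof.
case/(parent_exists (valP x) (valP r)) => C pxC Cr.
have /parentP[_ CL xC _] := pxC; exists (Sub C CL).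
by split; rewrite //= /tree_adj pxC.
Qed.

Lemma laminar_tree_is_tree : is_tree laminar_tree.
Proof.
split; last exact: laminar_tree_acyclic.
pose root : laminar_tree := Sub setT (setU11 _ _).
apply: (@connected_of_descent _ root (fun x => #|~: val x|)) => x x_root.
have [|y [xy x_y _]] := @laminar_tree_climb x root.
  by rewrite properT; apply: contra x_root => /eqP xT; apply/eqP/val_inj.
by exists y; rewrite // proper_card // properC.
Qed.

End LaminarTree.

Section LaminarDecomposition.
Variables (G : sgraph) (L : {set {set G}}).
Implicit Types (A C D X : {set G}) (u v w : G).

Definition bag A :=
  A :\: \bigcup_(C in nodes L | C \proper A) (C :\: boundary C).

Definition core A := A :\: \bigcup_(C in nodes L | C \proper A) C.

Lemma bagP A v :
  reflect (v \in A /\ forall C, C \in nodes L -> C \proper A -> v \in C ->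
             v \in boundary C)
          (v \in bag A).
Proof.
apply: (iffP setDP) => -[vA bagA]; split=> //.
  move=> C CL CA vC; apply: contraR bagA => vNb.
  by apply/bigcupP; exists C; rewrite ?CL // inE vNb.
by apply/bigcupP => -[C /andP[CL CA] /setDP[vC]]; rewrite bagA.
Qed.

Lemma bag_sub A : bag A \subset A.
Proof. exact: subsetDl. Qed.

Lemma bag_mono A C v : C \subset A -> v \in bag A -> v \in C -> v \in bag C.
Proof.
move=> CA /bagP[_ bagA] vC; apply/bagP; split=> // D DL DC.
exact: bagA (proper_sub_trans DC CA).
Qed.

Lemma bag_parent A C : parent L C A -> bag C :&: bag A \subset boundary C.
Proof.
case/parentP=> CL _ CA _; apply/subsetP => v /setIP[vC /bagP[_ bagA]].
exact: bagA (subsetP (bag_sub C) v vC).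
Qed.

Lemma clique_sub_bag (K : {set G}) :
  {in K &, forall u v, u != v -> u -- v} ->
  exists2 A, A \in nodes L & K \subset bag A.
Proof.
move=> cliqueK.
have [|A minA _] := @minset_exists _ [pred A in nodes L | K \subset A] setT.
  by rewrite inE /= setU11 subsetT.
have /andP[AL KA] := minsetp minA; exists A => //; apply/subsetP => u uK.
apply/bagP; split=> [|C CL CA uC]; first exact: (subsetP KA).
have /subsetPn[w wK wC] : ~~ (K \subset C).
  apply/negP => KC; have := CA.
  by rewrite (minsetinf minA _ (proper_sub CA)) ?properxx //= CL.
apply/boundaryP; split=> //; exists w => //; apply: cliqueK => //.
by apply: contraNneq wC => <-.
Qed.

Definition laminar_bag (x : laminar_tree L) := bag (val x).

Hypotheses (lamL : laminar L) (L0 : set0 \notin L).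

Lemma laminar_bag_connected v :
  connected_graph (induced [set x : laminar_tree L | v \in laminar_bag x]).
Proof.
set V := [set x | _]; have bagV (x : induced V) : v \in bag (val (val x)).
  by have := valP x; rewrite inE.
have [|A AL] := clique_sub_bag (K := [set v]).
  by move=> u w /set1P-> /set1P->; rewrite eqxx.
rewrite sub1set => vA; pose a : laminar_tree L := Sub A AL.
have aV : a \in V by rewrite inE.
have [r _ max_r] := @arg_maxnP _ (exist _ a aV : induced V) xpredT
  (fun x => #|val (val x)|) isT.
apply: (@connected_of_descent _ r (fun x => #|~: val (val x)|)) => x x_r.
have vx := subsetP (bag_sub _) _ (bagV x).
have vr := subsetP (bag_sub _) _ (bagV r).
have xr : val (val x) \proper val (val r).
  rewrite properEneq; apply/andP; split.
    by apply: contra x_r => /eqP xr; apply/eqP/val_inj/val_inj.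
  have [//|rx] := nodes_nested lamL (valP (val x)) (valP (val r)) vx vr.
  suff /eqP-> : val (val r) == val (val x) by [].
  by rewrite eqEcard rx; apply: max_r.
have [y [xy x_y yr]] := laminar_tree_climb lamL L0 xr.
have yV : y \in V.
  by rewrite inE; apply: bag_mono yr (bagV r) (subsetP (proper_sub x_y) _ vx).
by exists (exist _ y yV : induced V); rewrite // proper_card // properC.
Qed.

Lemma laminar_tree_decomposition : tree_decomposition laminar_bag.
Proof.
split; [exact: laminar_tree_is_tree|exact: laminar_bag_connected|].
move=> u v uv; have [|A AL uvA] := clique_sub_bag (K := [set u; v]).
  by move=> a b /set2P[]-> /set2P[]->; rewrite ?eqxx // adj_sym.
exists (Sub A AL : laminar_tree L); rewrite /laminar_bag /=.
by split; apply: (subsetP uvA); rewrite ?set21 ?set22.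
Qed.

Lemma core_inseparable A u v X : A \in nodes L ->
  u \in core A -> v \in core A -> X \in L -> ~~ separates u v X.
Proof.
move=> AL; wlog uX : u v / u \in X => [wlog_in uA vA XL|].
  have [uX|uX] := boolP (u \in X); first exact: wlog_in.
  have [vX|vX] := boolP (v \in X); first by rewrite separatesC wlog_in.
  by rewrite /separates (negPf uX) (negPf vX).
move=> /setDP[uA uN] /setDP[vA _] XL.
have XN : X \in nodes L by rewrite setU1r.
have AX : A \subset X.
  have [//|XA] := nodes_nested lamL AL XN uA uX; apply: contraR uN => nAX.
  by apply/bigcupP; exists X; rewrite // XN properE XA.
by rewrite /separates !(subsetP AX).
Qed.

(* The only adhesion sets of x through a vertex of the child C are the
   boundaries of C and of x itself. *)
Lemma torso_neighbour (x : laminar_tree L) (v w : torso laminar_bag x) C :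
  parent L C (val x) -> val v \in C -> v -- w ->
  val w \in boundary C :|: boundary (val x)
            :|: [set u | (val v -- u) && (u \notin C)].
Proof.
move=> pCx vC vw; have wx : val w \in laminar_bag x := valP w.
have /parentP[CL _ Cx _] := pCx; have /bagP[_ bag_x] := wx.
rewrite !in_setU; have [wC|wC] := boolP (val w \in C); first by rewrite bag_x.
case/orP: vw => [vw|/andP[_ /existsP[y /and3P[xy /setIP[_ vy] /setIP[_ wy]]]]].
  by apply/orP; right; rewrite in_set wC andbT.
case/orP: xy => [pxy|pyx].
  by rewrite (subsetP (bag_parent pxy)) ?orbT // inE wx.
have /subsetP sub_y := bag_sub (val y).
by case/negP: wC; rewrite (siblings_eq lamL pCx pyx vC (sub_y _ vy)) sub_y.
Qed.

Variable k : nat.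
Hypothesis cutL : forall X, X \in L -> cut X <= k.

Lemma nodes_cut A : A \in nodes L -> cut A <= k.
Proof. by case/setU1P=> [->|]; [rewrite cutT|apply: cutL]. Qed.

Lemma card_boundary_node A : A \in nodes L -> #|boundary A| <= k.
Proof. by move/nodes_cut; apply: leq_trans (card_boundary A). Qed.

Lemma laminar_adhesion : adhesion laminar_bag <= k.
Proof.
apply/bigmax_leqP => -[x y] /= /orP[]/bag_parent/subset_leq_card le_card.
  exact: leq_trans le_card (card_boundary_node (valP x)).
by rewrite setIC; apply: leq_trans le_card (card_boundary_node (valP y)).
Qed.

Lemma torso_degree (x : laminar_tree L) (v : torso laminar_bag x) :
  val v \notin core (val x) -> degree v <= 3 * k.
Proof.
have /bagP[vx _] := valP v; rewrite inE vx andbT negbK.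
case/bigcupP=> C0 /andP[C0L C0x] vC0.
have [C pCx vC] := child_exists lamL (valP x) C0L C0x vC0.
have /parentP[CL _ _ _] := pCx; rewrite /degree -(card_imset _ val_inj).
set N := _ @: _; have /subset_leq_card : N \subset boundary C
    :|: boundary (val x) :|: [set u | (val v -- u) && (u \notin C)].
  by apply/subsetP => _ /imsetP[w + ->]; rewrite inE; apply: torso_neighbour.
move/leq_trans; apply; rewrite !mulSnr mul0n add0n.
apply: leq_trans (leq_card_setU _ _) (leq_add _ _); last first.
  exact: leq_trans (card_outer_neighbours vC) (nodes_cut CL).
apply: leq_trans (leq_card_setU _ _) (leq_add _ _).
  exact: card_boundary_node CL.
exact: card_boundary_node (valP x).
Qed.

Lemma torso_bounded_degree (x : laminar_tree L) c d :
  #|core (val x)| <= c -> 3 * k <= d ->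
  bounded_degree c d (torso laminar_bag x).
Proof.
move=> core_c k_d; apply: leq_trans core_c; rewrite -(card_imset _ val_inj).
apply/subset_leq_card/subsetP => _ /imsetP[v + ->]; rewrite inE.
apply: contraTT => /torso_degree deg_v.
by rewrite -leqNgt (leq_trans deg_v).
Qed.

End LaminarDecomposition.

Lemma card_inseparable (H G : sgraph) (S : {set G}) :
  ~ weak_immersion H G ->
  {in S &, forall u v X, cut X <= #|H| ^ 2 -> ~~ separates u v X} ->
  #|S| <= #|H|.
Proof.
move=> noH insep; rewrite leqNgt; apply/negP => ltHS; apply: noH.
have [s sS] : exists s, s \in S by apply/card_gt0P/(leq_ltn_trans _ ltHS).
have leHS : #|H| <= #|S :\ s| by move: ltHS; rewrite (cardsD1 s) sS.
pose f (v : H) := enum_val (widen_ord leHS (enum_rank v)).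
have fS v : f v \in S.
  by have /setD1P[] := enum_valP (widen_ord leHS (enum_rank v)).
apply: (weak_immersion_of_hub (s := s) (f := f)) => [v w|X v sX fvX].
  by move/enum_val_inj/(congr1 val) => eq_rank; apply/enum_rank_inj/val_inj.
rewrite leqNgt; apply: contra sX => /ltnW cutX.
by have := insep _ _ (fS v) sS X cutX; rewrite /separates fvX negbK => /eqP<-.
Qed.

Theorem theorem9 (t : nat) (H : sgraph) (hH : #|H| = t)
  (G : sgraph) (hG : ~ weak_immersion H G) :
  exists (T : sgraph) (B : T -> {set G}),
    [/\ tree_decomposition B,
        adhesion B <= t ^ 2
      & forall x : T, bounded_degree t (t ^ 4 + 2 * t ^ 2) (torso B x)].
Proof.
have [L [lamL L0 cutL sepL]] :=
  laminar_separators (t ^ 2) (@submodular_cut G) (@posimodular_cut G).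
exists (laminar_tree L), (@laminar_bag G L); split.
- exact: laminar_tree_decomposition.
- exact: laminar_adhesion.
move=> x; apply: (torso_bounded_degree lamL cutL).
  rewrite -hH; apply: card_inseparable hG _ => u v ux vx X; rewrite hH => cutX.
  apply/negP => /(sepL _ _ _ cutX)[Y YL]; apply/negP.
  by apply: core_inseparable ux vx YL; last exact: valP.
have : t ^ 2 <= t ^ 4 by case: (t) => // n; rewrite leq_pexp2l.
lia.
Qed.
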